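(* Let $K$ be a number field, $S$ a finite set of primes of $K$, and $L/K$ a Galois extension, unramified outside $S^{(2)}$, with $\operatorname{Gal}(L/K)\simeq C_2$. (1) Let $E$ be an elliptic curve over $K$ with good reduction outside $S$, with $j$-invariant different from $0$ and $1728$, and whose $2$-division field is $L$; let $\Lambda\subset\mathcal O^*_{L,S_L}$ be the set of values of the $\lambda$-invariant of $E$. Then there exists $\lambda\in\Lambda$ such that $\lambda\in\mathcal O^*_{L,K,S_L,1}$. (2) Conversely, let $\lambda\in\mathcal O^*_{L,S_L}$, put $\mu=1-\lambda$, $j=2^8\frac{(\lambda^2-\lambda+1)^3}{\lambda^2(1-\lambda)^2}$ and $w=j^2(j-1728)^3$, and assume $j\neq 0,1728$. If $\mu\in\mathcal O^*_{L,S_L}$ and $\lambda\in\mathcal O^*_{L,K,S_L,1}$, then $j\in\mathcal O_{K,S}$. Moreover, if $w\in K(S,6)_{12}$, then $j$ is the $j$-invariant of an elliptic curve over $K$ with good reduction outside $S^{(6)}$.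
   Context: Primes are non-archimedean. For $n\ge 1$, $S^{(n)}=S\cup\{\mathfrak p:\operatorname{ord}_{\mathfrak p}(n)>0\}$. $\mathcal O_{K,S}$ is the ring of $S$-integers of $K$ (elements with $\operatorname{ord}_{\mathfrak p}\ge 0$ for all primes $\mathfrak p\notin S$ of $K$). $S_L$ is the set of primes of $L$ lying above primes in $S^{(2)}$. $\mathcal O^*_{L,S_L}$ is the group of $S_L$-units: $x\in L^*$ with $\operatorname{ord}_{\mathfrak B}(x)=0$ for all primes $\mathfrak B\notin S_L$ of $L$. $\mathcal O^*_{L,K,S_L,1}=\{x\in\mathcal O^*_{L,S_L}:\operatorname{Norm}_{L/K}(x)=1\}$. $K(S,n)=\{x\in K^*/K^{*n}:\operatorname{ord}_{\mathfrak p}(x)\equiv 0 \bmod n\ \ \forall \mathfrak p\notin S\}$, and for $n\mid m$, $K(S,n)_m$ is the image of the natural map $K(S,m)\to K(S,n)$; ''$w\in K(S,6)_{12}$'' means that the class of $w\in K^*$ in $K^*/K^{*6}$ lies there. For an elliptic curve $E:y^2+a_1xy+a_3y=x^3+a_2x^2+a_4x+a_6$ over $K$, let $e_1,e_2,e_3$ be the roots of the $2$-division polynomial $f_2=4x^3+b_2x^2+2b_4x+b_6$, where $b_2=a_1^2+4a_2$, $b_4=2a_4+a_1a_3$, $b_6=a_3^2+4a_6$. The $2$-division field of $E$ is $K(e_1,e_2,e_3)$. The $\lambda$-invariant is $\lambda=\frac{e_1-e_3}{e_1-e_2}$; it depends on the ordering of the roots, and its possible values form the set $\Lambda=\{\l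ambda,1-\lambda,\frac1\lambda,\frac1{1-\lambda},1-\frac1\lambda,\frac{\lambda}{\lambda-1}\}$.
   Formalization: In (2), ''j in O_{K,S}'' is replaced by ''j in O_{K,S^(2)}'': the original fails for K=Q, S={7}, L=Q(√-7), λ=(a/a')^5 with a=(1+√-7)/2 and a' its conjugate, where j=-15625/28 is not integral at 2. *)

(* Defs.v *)
From HB Require Import structures.
From mathcomp Require Import all_boot all_order all_algebra all_fingroup.
From mathcomp Require Import all_solvable all_field.
From mathcomp Require Import boolp classical_sets functions cardinality.

Set Implicit Arguments.
Unset Strict Implicit.
Unset Printing Implicit Defensive.

Import Order.TTheory GRing.Theory Num.Theory.
Local Open Scope classical_set_scope.
Local Open Scope ring_scope.

(* A prime is a finite place, represented by its normalized discrete valuation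
   ord : F^* ->> Z; over a number field these correspond bijectively to the
   nonzero prime ideals of the ring of integers.  The junk value ord 0 = 0
   stands for +oo: it is fixed so that each place has exactly one
   representative, and so that 0 satisfies every condition "0 <= ord x". *)
Record place (F : fieldType) := Place {
  ord :> F -> int;
  ord0 : ord 0 = 0;
  ordM : forall x y, x != 0 -> y != 0 -> ord (x * y) = ord x + ord y;
  ordD : forall x y, x != 0 -> y != 0 -> x + y != 0 ->
           Num.min (ord x) (ord y) <= ord (x + y);
  ord_surj : exists x, ord x = 1
}.

Section SUnits.
Variables (F : fieldType) (S : set (place F)).

Definition extend_places (n : nat) : set (place F) :=
  S `|` [set p : place F | 0 < p n%:R].

Definition S_integers : set F :=
  [set x | forall p : place F, ~ S p -> 0 <= p x].

Definition S_units : set F :=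
  [set x | x != 0 /\ forall p : place F, ~ S p -> p x = 0].

(* K(S,n) and K(S,n)_m are subgroups of K^*/K^{*n}; both are given here by
   their full preimages in K^*. *)
Definition selmer (n : nat) : set F :=
  [set x | x != 0 /\ forall p : place F, ~ S p -> (n %| p x)%Z].

Definition selmer_image (n m : nat) : set F :=
  [set w | exists x y, [/\ selmer m x, y != 0 & w = x * y ^+ n]].

End SUnits.

Section Extension.
Variables (K : fieldType) (L : splittingFieldType K).

Definition ramification_index (P : place L) (p : place K) (e : nat) : Prop :=
  (0 < e)%N /\ forall x : K, P x%:A = e%:Z * p x.

Definition lies_above (P : place L) (p : place K) : Prop :=
  exists e, ramification_index P p e.

Definition places_above (T : set (place K)) : set (place L) :=
  [set P | exists2 p, T p & lies_above P p].

(* Residue fields of number fields are finite, so the residue extensions are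
   automatically separable and only the ramification index matters. *)
Definition unramified_outside (T : set (place K)) : Prop :=
  forall (p : place K) (P : place L) (e : nat),
    ~ T p -> ramification_index P p e -> e = 1%N.

(* galNorm is the field norm because L/K is assumed to be Galois wherever this
   is used. *)
Definition norm1_S_units (T : set (place L)) : set L :=
  [set x | S_units T x /\ galNorm 1 {:L} x = 1].

End Extension.

Record weierstrass (F : fieldType) := Weierstrass {
  wa1 : F; wa2 : F; wa3 : F; wa4 : F; wa6 : F
}.

Section Weierstrass.
Variables (F : fieldType) (E : weierstrass F).
Local Notation a1 := (wa1 E).
Local Notation a2 := (wa2 E).
Local Notation a3 := (wa3 E).
Local Notation a4 := (wa4 E).
Local Notation a6 := (wa6 E).

Definition b2 : F := a1 ^+ 2 + 4%:R * a2.
Definition b4 : F := 2%:R * a4 + a1 * a3.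
Definition b6 : F := a3 ^+ 2 + 4%:R * a6.
Definition b8 : F :=
  a1 ^+ 2 * a6 + 4%:R * a2 * a6 - a1 * a3 * a4 + a2 * a3 ^+ 2 - a4 ^+ 2.
Definition c4 : F := b2 ^+ 2 - 24%:R * b4.
Definition discriminant : F :=
  - b2 ^+ 2 * b8 - 8%:R * b4 ^+ 3 - 27%:R * b6 ^+ 2 + 9%:R * b2 * b4 * b6.
Definition j_invariant : F := c4 ^+ 3 / discriminant.

Definition two_division_poly : {poly F} :=
  4%:R *: 'X^3 + b2 *: 'X^2 + (2%:R * b4) *: 'X + b6%:P.

(* x = u^2 x' + r,  y = u^3 y' + u^2 s x' + t *)
Definition change_coordinates (u r s t : F) : weierstrass F :=
  {| wa1 := (a1 + 2%:R * s) / u;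
     wa2 := (a2 - s * a1 + 3%:R * r - s ^+ 2) / u ^+ 2;
     wa3 := (a3 + r * a1 + 2%:R * t) / u ^+ 3;
     wa4 := (a4 - s * a3 + 2%:R * r * a2 - (t + r * s) * a1 + 3%:R * r ^+ 2
               - 2%:R * s * t) / u ^+ 4;
     wa6 := (a6 + r * a4 + r ^+ 2 * a2 + r ^+ 3 - t * a3 - t ^+ 2
               - r * t * a1) / u ^+ 6 |}.

Definition integral_at (p : place F) : Prop :=
  [/\ 0 <= p a1, 0 <= p a2, 0 <= p a3, 0 <= p a4 & 0 <= p a6].

End Weierstrass.

Record elliptic_curve (F : fieldType) := EllipticCurve {
  model :> weierstrass F;
  discriminant_neq0 : discriminant model != 0
}.

Definition good_reduction (F : fieldType) (E : elliptic_curve F)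
    (p : place F) : Prop :=
  exists u r s t : F,
    [/\ u != 0,
        integral_at (change_coordinates E u r s t) p
      & p (discriminant (change_coordinates E u r s t)) = 0].

Definition good_reduction_outside (F : fieldType) (E : elliptic_curve F)
    (S : set (place F)) : Prop :=
  forall p : place F, ~ S p -> good_reduction E p.

(* (e1, e2, e3) lists the roots, with multiplicity, of f_2 in L, and
   L = K(e1, e2, e3). *)
Definition two_division_field (K : fieldType) (L : splittingFieldType K)
    (E : elliptic_curve K) (e1 e2 e3 : L) : Prop :=
  map_poly (in_alg L) (two_division_poly E)
    = 4%:R *: (('X - e1%:P) * ('X - e2%:P) * ('X - e3%:P))
  /\ <<1 & [:: e1; e2; e3]>>%VS = {:L}%VS.

Definition lambda_values (F : fieldType) (e1 e2 e3 : F) : seq F :=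
  let l := (e1 - e3) / (e1 - e2) in
  [:: l; 1 - l; l^-1; (1 - l)^-1; 1 - l^-1; l / (l - 1)].

(* When l and 1 - l are units at a place above 2 so is the denominator, but at
   places above 2 where they are not, this can fail to be integral even if l has
   norm 1.  Over Q(sqrt(-7)), with a = (1 + sqrt(-7))/2 and conjugate a', the
   element l = (a/a')^5 has norm 1, l and 1 - l are {2,7}-units, and
   lambda_j l = -15625/28.  Thus integrality of lambda_j l can only be claimed
   outside S^(2), not outside S. *)
Definition lambda_j (F : fieldType) (l : F) : F :=
  2%:R ^+ 8 * (l ^+ 2 - l + 1) ^+ 3 / (l ^+ 2 * (1 - l) ^+ 2).

(* Main.v *)
Require Import Defs.
From mathcomp Require Import all_boot all_order all_algebra all_fingroup.
From mathcomp Require Import all_solvable all_field.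
From mathcomp Require Import boolp classical_sets functions cardinality.
From mathcomp Require Import zify ring.

Set Implicit Arguments.
Unset Strict Implicit.
Unset Printing Implicit Defensive.

Import Order.TTheory GRing.Theory Num.Theory.
Local Open Scope classical_set_scope.
Local Open Scope ring_scope.

(** Let s be the conjugation of L/K.

    For an elliptic curve with full 2-torsion over L, the discriminant is
    16 times the square of the product of the differences of the roots e_i of
    the 2-division polynomial.  Let P be a place of L over a place p of K that is
    odd and of good reduction.  In a good model at p the roots are P-integral
    and the discriminant is a unit, so the differences are units; in the given
    model they all have the valuation of one square u^2, so every lambda-value,
    being a quotient of two differences up to sign, is a unit at P
    ([good_reduction_two_torsion]).  As s permutes the e_i and has order 2, it
    fixes one root and swaps the other two, and the lambda-value centred at the
    fixed root is inverted by s ([exists_norm1_lambda]).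

    Conversely, if l has norm 1 then s l = 1 / l, and j is invariant under
    l |-> 1 / l, so j lies in K.  Integrality of j at p is read off at a place P
    of L over p, where l and 1 - l are units ([lambda_j_integral]).  When
    j^2 (j - 1728)^3 = x y^6, the curve with c4 = j (j - 1728) / y^2 and
    c6 = j (j - 1728)^2 / y^3 has invariant j and discriminant x; if 12 divides
    p x, scaling makes x a unit at p, and c4^3 = j x, c6^2 = (j - 1728) x show
    that c4 and c6 stay integral ([short_good_reduction]).

    Both directions compare places of K and L.  A place of L is
    nontrivial on K because an element of valuation 1 would otherwise have a
    trace of valuation -1 ([place_below]).  The existence of a place of L over p ([place_above]) rests on
    a dichotomy.  Either every element of L with p-integral norm has p-integral
    trace, and then p composed with the norm is a multiple of a place; or some
    element violates this, its minimal polynomial rescales to X^2 - X + h with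
    p h > 0, which splits over the completion of K at p, and a place is the limit
    of the valuations of a + b y_n for approximations y_n to a root. *)

(** * Discrete valuations *)

(** A place without the normalization [ord_surj].  Restricting a place to a
    subfield, or composing one with a norm, only gives such a function. *)
Definition is_valuation (F : fieldType) (v : F -> int) : Prop :=
  [/\ v 0 = 0,
      forall x y, x != 0 -> y != 0 -> v (x * y) = v x + v y
    & forall x y, x != 0 -> y != 0 -> x + y != 0 ->
        Num.min (v x) (v y) <= v (x + y)].

Lemma place_is_valuation (F : fieldType) (p : place F) : is_valuation p.
Proof. by split; [exact: Defs.ord0 | exact: ordM | exact: ordD]. Qed.

(** The condition v x >= c with v 0 read as +oo; unlike the bare inequality,
    it is stable under sums and products for every bound c. *)
Definition val_ge (F : fieldType) (v : F -> int) (c : int) (x : F) : bool :=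
  (x == 0) || (c <= v x).

Section Valuation.
Variables (F : fieldType) (v : F -> int).
Hypothesis v_val : is_valuation v.

Lemma valuationM x y : x != 0 -> y != 0 -> v (x * y) = v x + v y.
Proof. by case: v_val => _ h _; exact: h. Qed.

Lemma valuation0 : v 0 = 0. Proof. by case: v_val. Qed.

Lemma valuation1 : v 1 = 0.
Proof.
have := @valuationM 1 1 (oner_neq0 F) (oner_neq0 F); rewrite mulr1.
by move/eqP; rewrite -subr_eq0 opprD addrA subrr add0r oppr_eq0 => /eqP.
Qed.

Lemma valuationN x : v (- x) = v x.
Proof.
have m1 : (-1 : F) != 0 by rewrite oppr_eq0 oner_eq0.
have vm1 : v (-1) = 0 by have := valuationM m1 m1; rewrite mulrNN mulr1 valuation1; lia.
have [->|x0] := eqVneq x 0; first by rewrite oppr0.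
by rewrite -mulN1r valuationM // vm1 add0r.
Qed.

Lemma valuationV x : v x^-1 = - v x.
Proof.
have [->|x0] := eqVneq x 0; first by rewrite invr0 valuation0.
by have := valuationM x0 (invr_neq0 x0); rewrite divff // valuation1; lia.
Qed.

Lemma valuation_div x y : x != 0 -> y != 0 -> v (x / y) = v x - v y.
Proof. by move=> x0 y0; rewrite valuationM ?invr_eq0 // valuationV. Qed.

Lemma valuationX x n : v (x ^+ n) = n%:Z * v x.
Proof.
have [->|x0] := eqVneq x 0.
  by rewrite expr0n; case: n => [|n] /=; rewrite ?valuation0 ?valuation1; lia.
elim: n => [|n IHn]; first by rewrite expr0 valuation1 mul0r.
by rewrite exprS valuationM ?expf_neq0 // IHn; lia.
Qed.

Lemma valuation_exprz x (m : int) : v (x ^ m) = m * v x.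
Proof.
case: m => n; first by rewrite -exprnP valuationX.
by rewrite NegzE -exprnN valuationV valuationX; lia.
Qed.

Lemma val_geP c x : reflect (x = 0 \/ c <= v x) (val_ge v c x).
Proof.
by apply: (iffP orP) => -[h|h]; [left; apply/eqP | right | left; apply/eqP | right].
Qed.

Lemma val_ge_val x c : x != 0 -> val_ge v c x = (c <= v x).
Proof. by rewrite /val_ge => /negPf->. Qed.

Lemma val_ge_refl x : val_ge v (v x) x.
Proof. by rewrite /val_ge lexx orbT. Qed.

Lemma val_ge0E x : val_ge v 0 x = (0 <= v x).
Proof. by rewrite /val_ge; case: eqP => // ->; rewrite valuation0. Qed.

Lemma val_ge_le c d x : d <= c -> val_ge v c x -> val_ge v d x.
Proof.
by move=> dc /val_geP[->|cx]; apply/val_geP; [left | right; lia].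
Qed.

Lemma val_geN c x : val_ge v c (- x) = val_ge v c x.
Proof. by rewrite /val_ge valuationN oppr_eq0. Qed.

Lemma val_geD c x y : val_ge v c x -> val_ge v c y -> val_ge v c (x + y).
Proof.
have [->|x0] := eqVneq x 0; first by rewrite add0r.
have [->|y0] := eqVneq y 0; first by rewrite addr0.
rewrite /val_ge (negPf x0) (negPf y0) /=.
have [//|xy0] := eqVneq (x + y) 0.
case: v_val => _ _ /(_ x y x0 y0 xy0); rewrite ge_min.
by case/orP=> h cx cy; exact: le_trans h.
Qed.

Lemma val_geB c x y : val_ge v c x -> val_ge v c y -> val_ge v c (x - y).
Proof. by move=> cx cy; apply: val_geD; rewrite ?val_geN. Qed.

Lemma val_geM c d x y :
  val_ge v c x -> val_ge v d y -> val_ge v (c + d) (x * y).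
Proof.
have [->|x0] := eqVneq x 0; first by rewrite mul0r /val_ge eqxx.
have [->|y0] := eqVneq y 0; first by rewrite mulr0 /val_ge eqxx.
by rewrite !val_ge_val ?mulf_neq0 // valuationM //; lia.
Qed.

Lemma val_int_add x y : 0 <= v x -> 0 <= v y -> 0 <= v (x + y).
Proof. by rewrite -!val_ge0E; exact: val_geD. Qed.

Lemma val_int_sub x y : 0 <= v x -> 0 <= v y -> 0 <= v (x - y).
Proof. by rewrite -!val_ge0E; exact: val_geB. Qed.

Lemma val_int_mul x y : 0 <= v x -> 0 <= v y -> 0 <= v (x * y).
Proof. by rewrite -!val_ge0E -[X in val_ge v X (_ * _)](addr0 0); exact: val_geM. Qed.

Lemma val_int_nat n : 0 <= v n%:R.
Proof.
elim: n => [|n IHn]; first by rewrite valuation0.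
by rewrite -addn1 natrD val_int_add // valuation1.
Qed.

Lemma val_int_exp x n : 0 <= v x -> 0 <= v (x ^+ n).
Proof. by rewrite valuationX; nia. Qed.

(** Since x = (x + y) - y, a larger valuation of the sum would force a larger
    valuation of x. *)
Lemma val_add_dominant x y : x != 0 -> val_ge v (v x + 1) y ->
  x + y != 0 /\ v (x + y) = v x.
Proof.
move=> x0 xy; have ge1 : val_ge v (v x) (x + y).
  by apply: val_geD (val_ge_refl x) _; apply: val_ge_le xy; lia.
have xy0 : x + y != 0.
  apply/eqP => /eqP; rewrite addr_eq0 => /eqP xyN.
  by move: xy; rewrite -val_geN -xyN val_ge_val //; lia.
split=> //; move: ge1; rewrite val_ge_val // => ge1.
suff : ~~ (v x + 1 <= v (x + y)) by lia.
apply/negP => gt1; suff : val_ge v (v x + 1) x by rewrite val_ge_val //; lia.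
rewrite -[X in val_ge _ _ X](addrK y); apply: val_geB => //.
by rewrite val_ge_val.
Qed.

(** The image of v is a nonzero subgroup e Z of Z, so v / e is a place. *)
Lemma normalize_valuation : (exists x, v x != 0) ->
  exists (p : place F) (e : nat), (0 < e)%N /\ forall x, v x = e%:Z * p x.
Proof.
move=> [x vx0].
have exn : exists n : nat, `[< (0 < n)%N /\ exists y, v y = n%:Z >].
  have [vx|vx] : 0 < v x \/ v x < 0 by move: vx0; lia.
    by exists `|v x|%N; apply/asboolP; split; [lia | exists x; lia].
  exists `|v x|%N; apply/asboolP; split; first by lia.
  by exists x^-1; rewrite valuationV; lia.
case: (ex_minnP exn) => e /asboolP[e_gt0 [z vz]] e_min.
have z0 : z != 0 by apply/eqP => z0; move: vz; rewrite z0 valuation0; lia.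
have e_dvd y : v y = e%:Z * (v y %/ e%:Z)%Z.
  have [->|y0] := eqVneq y 0; first by rewrite valuation0 div0z mulr0.
  have := divz_eq (v y) e%:Z; set q := (v y %/ e%:Z)%Z; set r := (v y %% e%:Z)%Z.
  have r_ge0 : 0 <= r by apply: modz_ge0; lia.
  have r_lt : r < e%:Z by apply: ltz_pmod; lia.
  move=> vy; have [r0|r_neq0] := eqVneq r 0; first by rewrite r0 in vy; lia.
  have : (e <= `|r|)%N.
    apply: e_min; apply/asboolP; split; first by lia.
    exists (y / z ^ q); rewrite valuation_div ?expfz_neq0 // valuation_exprz vz; lia.
  lia.
pose f y := (v y %/ e%:Z)%Z.
have f0 : f 0 = 0 by rewrite /f valuation0 div0z.
have e_gt0' : 0 < e%:Z by [].
have fM : forall a b, a != 0 -> b != 0 -> f (a * b) = f a + f b.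
  move=> a b a0 b0; apply: (mulfI (lt0r_neq0 e_gt0')).
  by rewrite mulrDr -!e_dvd valuationM.
have fD : forall a b, a != 0 -> b != 0 -> a + b != 0 ->
    Num.min (f a) (f b) <= f (a + b).
  move=> a b a0 b0 ab0; case: v_val => _ _ /(_ a b a0 b0 ab0).
  rewrite (e_dvd a) (e_dvd b) (e_dvd (a + b)) -/(f a) -/(f b) -/(f (a + b)).
  by rewrite -minr_pMr ?ler_pM2l // ltW.
have f1 : exists x, f x = 1 by exists z; rewrite /f vz divzz; lia.
by exists (Place f0 fM fD f1), e; split.
Qed.

End Valuation.

Lemma place_eq (F : fieldType) (p q : place F) : p =1 q -> p = q.
Proof.
case: p => f f0 fM fD f1; case: q => g g0 gM gD g1 /= fg.
have {}fg : f = g by apply/funext.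
by subst g; congr Place; exact: Prop_irrelevance.
Qed.

(** * Places above and below in a quadratic extension *)

Section ScalarEmbedding.
Variables (K : fieldType) (L : splittingFieldType K).
Implicit Types k l : K.

Lemma scalar_inj k l : k%:A = l%:A :> L -> k = l.
Proof. exact: (fmorph_inj (in_alg L)). Qed.

Lemma scalar_eq0 k : (k%:A == 0 :> L) = (k == 0).
Proof. by rewrite scaler_eq0 oner_eq0 orbF. Qed.

Lemma scalarM k l : (k * l)%:A = k%:A * l%:A :> L.
Proof. exact: (rmorphM (in_alg L)). Qed.

Lemma scalarX k n : (k ^+ n)%:A = k%:A ^+ n :> L.
Proof. exact: (rmorphXn (in_alg L)). Qed.

Lemma scalarV k : (k^-1)%:A = (k%:A)^-1 :> L.
Proof. exact: (fmorphV (in_alg L)). Qed.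

Lemma scalar_nat n : (n%:R : K)%:A = n%:R :> L.
Proof. exact: (rmorph_nat (in_alg L)). Qed.

Definition scalarE := (scalerDl, scaleNr, scalarM, scalarX, scalarV,
  scalar_nat, scale1r, scale0r).
End ScalarEmbedding.

(** The factor c is 1 for a limit of values of p, and 2 for p composed with a
    quadratic norm; v itself need not be onto Z, whence the normalization. *)
Lemma place_above_of_valuation (K : fieldType) (L : splittingFieldType K)
    (p : place K) (v : L -> int) (c : int) :
  is_valuation v -> 0 < c -> (forall k : K, v k%:A = c * p k) ->
  exists P : place L, lies_above P p.
Proof.
move=> v_val c_gt0 vK; have [pi ppi] := ord_surj p.
have [|P [e [e_gt0 vE]]] := normalize_valuation v_val.
  by exists pi%:A; rewrite vK ppi; lia.
have cE : c = e%:Z * P pi%:A by rewrite -vE vK ppi mulr1.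
have Ppi_gt0 : 0 < P pi%:A by rewrite -(pmulr_rgt0 _ (_ : 0 < e%:Z)) // -cE.
exists P, `|P pi%:A|%N; split; first by rewrite absz_gt0 gt_eqF.
move=> k; have e0 : e%:Z != 0 by rewrite -lt0n in e_gt0 *; lia.
by apply: (mulfI e0); rewrite -vE vK cE gez0_abs ?mulrA // ltW.
Qed.

(** As p and q both take the value 1, the two ramification indices divide each
    other. *)
Lemma lies_above_inj (K : fieldType) (L : splittingFieldType K) (P : place L)
    (p q : place K) : lies_above P p -> lies_above P q -> p = q.
Proof.
move=> [e [e_gt0 Pp]] [f [f_gt0 Pq]]; apply: place_eq => k.
have [x px] := ord_surj p; have [y qy] := ord_surj q.
have pq z : e%:Z * p z = f%:Z * q z by rewrite -Pp Pq.
have e0 : 0 < e%:Z by []; have f0 : 0 < f%:Z by [].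
have qx : 0 < q x by rewrite -(pmulr_rgt0 _ f0) -pq px mulr1.
have py : 0 < p y by rewrite -(pmulr_rgt0 _ e0) pq qy mulr1.
have ef : e = f by have := pq x; have := pq y; rewrite px qy; nia.
by apply: (mulfI (lt0r_neq0 e0)); rewrite pq ef.
Qed.

(** The split case.  Hensel iteration produces y_n in K converging p-adically to
    the root of Y^2 - Y + h of positive valuation; since K need not contain
    the limit, the place theta |-> lim y_n of L is obtained by evaluating at
    y_n and letting n grow. *)
Section Split.
Variables (K : fieldType) (L : splittingFieldType K) (p : place K).
Variables (theta : L) (h : K).
Hypothesis h_small : val_ge p 1 h.
Hypothesis thetaE : theta ^+ 2 = theta - h%:A.
Hypothesis theta_gen : forall x : L, exists c : K * K,
  x = c.1%:A + c.2%:A * theta.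
Hypothesis theta_free : forall a b : K,
  a%:A + b%:A * theta = 0 -> a = 0 /\ b = 0.

Let p_val : is_valuation p := place_is_valuation p.

(** Squaring contracts the maximal ideal whatever the residue characteristic, so
    the fixed point of y |-> y^2 + h is reached without any derivative. *)
Definition hensel_seq (n : nat) : K := iter n (fun y => y ^+ 2 + h) 0.
Definition hensel_step n := hensel_seq n.+1 - hensel_seq n.

Lemma hensel_seq_small n : val_ge p 1 (hensel_seq n).
Proof.
elim: n => [|n IHn]; first by rewrite /val_ge eqxx.
apply: (val_geD p_val) => //.
by apply: (@val_ge_le _ _ (1 + 1)) => //; apply: (val_geM p_val).
Qed.

Lemma hensel_step_small n : val_ge p n%:Z (hensel_step n).
Proof.
elim: n => [|n IHn].
  rewrite /hensel_step /hensel_seq /= expr0n add0r subr0.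
  exact: val_ge_le h_small.
have -> : hensel_step n.+1
    = hensel_step n * (hensel_seq n.+1 + hensel_seq n).
  by rewrite /hensel_step /hensel_seq /=; ring.
apply: (@val_ge_le _ _ (n%:Z + 1)); first by lia.
by apply: (val_geM p_val) => //; apply: (val_geD p_val); exact: hensel_seq_small.
Qed.

Definition theta_coord (x : L) : K * K := projT1 (cid (theta_gen x)).

Lemma theta_coordE x :
  x = (theta_coord x).1%:A + (theta_coord x).2%:A * theta.
Proof. exact: (projT2 (cid (theta_gen x))). Qed.

Lemma theta_coord_uniq (x : L) (a b : K) :
  x = a%:A + b%:A * theta -> theta_coord x = (a, b).
Proof.
move=> xE; have [|] := @theta_free (a - (theta_coord x).1) (b - (theta_coord x).2).
  rewrite !scalerBl; have := theta_coordE x; rewrite {1}xE => E.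
  by apply/eqP; rewrite mulrBl addrACA -opprD subr_eq0; apply/eqP.
move=> /eqP; rewrite subr_eq0 => /eqP-> /eqP; rewrite subr_eq0 => /eqP->.
by case: (theta_coord x).
Qed.

Definition hensel_eval n x := (theta_coord x).1 + (theta_coord x).2 * hensel_seq n.

Lemma hensel_evalD n x y :
  hensel_eval n (x + y) = hensel_eval n x + hensel_eval n y.
Proof.
rewrite /hensel_eval.
rewrite (@theta_coord_uniq (x + y) ((theta_coord x).1 + (theta_coord y).1)
   ((theta_coord x).2 + (theta_coord y).2)) /=; first by ring.
by rewrite {1}(theta_coordE x) {1}(theta_coordE y) !scalerDl; ring.
Qed.

Lemma hensel_eval_alg n (k : K) : hensel_eval n k%:A = k.
Proof.
rewrite /hensel_eval (@theta_coord_uniq k%:A k 0) /=; first by ring.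
by rewrite scale0r mul0r addr0.
Qed.

(** Evaluation at y_n fails to be multiplicative only because y_n need not be a
    root; the defect y_n^2 - y_n + h is [hensel_step n], which tends to 0. *)
Lemma hensel_evalM n x y :
  hensel_eval n (x * y) = hensel_eval n x * hensel_eval n y
     - (theta_coord x).2 * (theta_coord y).2 * hensel_step n.
Proof.
rewrite /hensel_eval.
set a := theta_coord x; set b := theta_coord y.
rewrite (@theta_coord_uniq (x * y) (a.1 * b.1 - a.2 * b.2 * h)
   (a.1 * b.2 + a.2 * b.1 + a.2 * b.2)) /=.
  by rewrite /hensel_step /hensel_seq /=; ring.
have -> : x * y = (a.1%:A + a.2%:A * theta) * (b.1%:A + b.2%:A * theta).
  by rewrite -!theta_coordE.
transitivity (a.1%:A * b.1%:A + (a.1%:A * b.2%:A + a.2%:A * b.1%:A) * theta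
   + a.2%:A * b.2%:A * theta ^+ 2); first by ring.
rewrite thetaE !scalarE; ring.
Qed.

Lemma hensel_evalS n x :
  hensel_eval n.+1 x = hensel_eval n x + (theta_coord x).2 * hensel_step n.
Proof. by rewrite /hensel_eval /hensel_step; ring. Qed.

(** The bound comes from the norm: the product of a + b y_n with the integral
    quantity a + b (1 - y_n) tends to the norm of a + b theta, which is a nonzero
    constant, so the valuation of a + b y_n is bounded while its increments
    tend to 0. *)
Lemma hensel_eval_stable (x : L) : x != 0 -> exists c : int, exists n0 : nat,
  forall n, (n0 <= n)%N -> hensel_eval n x != 0 /\ p (hensel_eval n x) = c.
Proof.
move=> x0; set a := (theta_coord x).1; set b := (theta_coord x).2.
pose N := a ^+ 2 + a * b + b ^+ 2 * h.
have xE : x = a%:A + b%:A * theta := theta_coordE x.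
have NE : N%:A = x * ((a + b)%:A - b%:A * theta).
  transitivity (a%:A ^+ 2 + a%:A * b%:A + b%:A ^+ 2 * (theta - theta ^+ 2)).
    by rewrite thetaE !scalarE; ring.
  by rewrite xE scalerDl; ring.
have N0 : N != 0.
  apply/eqP => N0; move: NE; rewrite N0 scale0r => /esym/eqP.
  rewrite mulf_eq0 (negPf x0) /= => /eqP xb0.
  have [|ab0 b0] := @theta_free (a + b) (- b).
    by rewrite scaleNr mulNr.
  have {}b0 : b = 0 by apply/eqP; rewrite -oppr_eq0 b0.
  move: ab0; rewrite b0 addr0 => a0.
  by move: x0; rewrite xE a0 b0 !scale0r mul0r addr0 eqxx.
have [m [ma mb]] : exists m, val_ge p m a /\ val_ge p m b.
  exists (Num.min (p a) (p b)); split; apply: val_ge_le (val_ge_refl _ _).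
    by rewrite ge_min lexx.
  by rewrite ge_min lexx orbT.
pose M := absz (p N - m - m)%R.
have key n : (M < n)%N ->
    hensel_eval n x != 0 /\ p (hensel_eval n x) <= p N - m.
  move=> Mn; pose z := a + b - b * hensel_seq n.
  have y_int : val_ge p 0 (hensel_seq n) by apply: val_ge_le (hensel_seq_small n).
  have mz : val_ge p m z.
    apply: (val_geB p_val); first exact: (val_geD p_val).
    by rewrite -[m]addr0; apply: (val_geM p_val).
  have NzE : N + (- (b ^+ 2 * hensel_step n)) = hensel_eval n x * z.
    by rewrite /N /z /hensel_eval -/a -/b /hensel_step /hensel_seq /=; ring.
  have [|Nz0 pNz] := val_add_dominant p_val (y := - (b ^+ 2 * hensel_step n)) N0.
    rewrite (val_geN p_val); apply: (@val_ge_le _ _ (m + m + n%:Z)).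
      by move: Mn; rewrite /M; lia.
    apply: (val_geM p_val) (hensel_step_small n).
    by rewrite expr2; apply: (val_geM p_val).
  move: Nz0; rewrite NzE mulf_eq0 negb_or => /andP[e0 z0]; split=> //.
  by move: pNz mz; rewrite NzE (valuationM p_val) // val_ge_val //; lia.
pose n0 := (M + 1)%N.
exists (p (hensel_eval n0 x)), n0 => n /subnKC <-; elim: (n - n0)%N => [|d [IH0 IHd]].
  rewrite addn0; split=> //.
  by case: (key n0) => //; rewrite /n0; lia.
rewrite addnS hensel_evalS.
have [|_ le_val] := key (n0 + d)%N; first by rewrite /n0; lia.
rewrite -IHd; apply: (val_add_dominant p_val) => //.
apply: (@val_ge_le _ _ (m + (n0 + d)%:Z)); first by rewrite /n0 /M in le_val *; lia.
by apply: (val_geM p_val) (hensel_step_small _).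
Qed.

Definition hensel_val (x : L) : int :=
  if pselect (x != 0) is left x0 then projT1 (cid (hensel_eval_stable x0)) else 0.

Lemma hensel_valP (x : L) : x != 0 -> exists n0 : nat, forall n, (n0 <= n)%N ->
  hensel_eval n x != 0 /\ p (hensel_eval n x) = hensel_val x.
Proof.
rewrite /hensel_val; case: pselect => // x0 _.
exact: (projT2 (cid (hensel_eval_stable x0))).
Qed.

Lemma hensel_val_alg (k : K) : hensel_val k%:A = p k.
Proof.
have [->|k0] := eqVneq k 0.
  rewrite scale0r Defs.ord0 /hensel_val; case: pselect => // zero_neq0.
  by case/negP: (zero_neq0).
have kA0 : k%:A != 0 :> L by rewrite scaler_eq0 oner_eq0 orbF.
have [n0 /(_ n0 (leqnn _))[_]] := hensel_valP kA0.
by rewrite hensel_eval_alg.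
Qed.

Lemma hensel_val_is_valuation : is_valuation hensel_val.
Proof.
split.
- by rewrite -(scale0r (1 : L)) hensel_val_alg Defs.ord0.
- move=> x y x0 y0; have xy0 := mulf_neq0 x0 y0.
  have [nx Hx] := hensel_valP x0; have [ny Hy] := hensel_valP y0.
  have [nxy Hxy] := hensel_valP xy0.
  set d := (theta_coord x).2 * (theta_coord y).2.
  pose n := (nx + ny + nxy + absz (hensel_val x + hensel_val y + 1 - p d)%R)%N.
  have [|ex px] := Hx n; first by rewrite /n; lia.
  have [|ey py] := Hy n; first by rewrite /n; lia.
  have [|_ <-] := Hxy n; first by rewrite /n; lia.
  rewrite hensel_evalM -px -py -(valuationM p_val ex ey).
  refine (proj2 (val_add_dominant p_val _ _)); first exact: mulf_neq0.
  rewrite (val_geN p_val) -/d (valuationM p_val ex ey) px py.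
  apply: (@val_ge_le _ _ (p d + n%:Z)); first by rewrite /n; lia.
  by apply: (val_geM p_val) (hensel_step_small n); exact: val_ge_refl.
- move=> x y x0 y0 xy0.
  have [nx Hx] := hensel_valP x0; have [ny Hy] := hensel_valP y0.
  have [nxy Hxy] := hensel_valP xy0.
  pose n := (nx + ny + nxy)%N.
  have [|ex <-] := Hx n; first by rewrite /n; lia.
  have [|ey <-] := Hy n; first by rewrite /n; lia.
  have [|+ <-] := Hxy n; first by rewrite /n; lia.
  by rewrite hensel_evalD; exact: ordD.
Qed.

Lemma split_place_above : exists P : place L, lies_above P p.
Proof.
apply: (place_above_of_valuation hensel_val_is_valuation ltr01) => k.
by rewrite hensel_val_alg mul1r.
Qed.

End Split.

Section Quadratic.
Variables (K : fieldType) (L : splittingFieldType K).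
Variable s : {rmorphism L -> L}.
Hypothesis s_alg : forall k : K, s k%:A = k%:A.
Hypothesis s_inv : involutive s.
Hypothesis s_fix : forall x : L, s x = x -> exists k : K, k%:A = x.

(** [normalize_valuation] supplies p and the index once the restriction is known
    to be nontrivial; this is where finiteness of L/K enters. *)
Lemma place_below (P : place L) : exists p : place K, lies_above P p.
Proof.
have P_val := place_is_valuation P.
have res_val : is_valuation (fun k : K => P k%:A).
  split=> [|x y x0 y0|x y x0 y0 xy0]; first by rewrite scale0r Defs.ord0.
    by rewrite scalarM; apply: ordM; rewrite scalar_eq0.
  by rewrite scalerDl; apply: ordD; rewrite -?scalerDl scalar_eq0.
have [[k Pk]|triv] := pselect (exists k : K, P k%:A != 0).
  have [|p [e [e_gt0 pE]]] := normalize_valuation res_val; first by exists k.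
  by exists p, e; split.
(* Were P trivial on K, an x with P x = 1 would have conjugate of valuation -1,
   hence a trace of valuation -1. *)
have {}triv (k : K) : P k%:A = 0.
  by apply/eqP/negPn/negP => Pk; apply: triv; exists k.
have [x Px] := ord_surj P.
have x0 : x != 0 by apply: contra_eqN Px => /eqP->; rewrite Defs.ord0.
have sx0 : s x != 0 by rewrite fmorph_eq0.
have [n nE] : exists n : K, n%:A = x * s x.
  by apply: s_fix; rewrite rmorphM s_inv mulrC.
have [t tE] : exists t : K, t%:A = s x + x.
  by apply: s_fix; rewrite rmorphD s_inv addrC.
have Psx : P (s x) = -1.
  by have := triv n; rewrite nE (valuationM P_val) // Px; lia.
have [|_] := val_add_dominant P_val (y := x) sx0.
  by rewrite Psx val_ge_val // Px.
by rewrite -tE triv Psx.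
Qed.

(** If integrality of the norm forces integrality of the trace, then the norm
    already pulls p back to a valuation.  Otherwise some z has
    p (Tr z) < 0 <= p (N z); the minimal polynomial of z / Tr z is then
    X^2 - X + h with p h > 0, which Hensel's lemma splits over the completion
    of K at p. *)
Lemma place_above (p : place K) : exists P : place L, lies_above P p.
Proof.
have p_val := place_is_valuation p.
pose down (x : L) : K := xget 0 [set k : K | k%:A = x]%classic.
have downE (x : L) : s x = x -> (down x)%:A = x.
  by move=> /s_fix; exact: (xgetPex (0 : K)).
pose N (x : L) : K := down (x * s x); pose T (x : L) : K := down (x + s x).
have NE (x : L) : (N x)%:A = x * s x :> L by apply: downE; rewrite rmorphM s_inv mulrC.
have TE (x : L) : (T x)%:A = x + s x :> L by apply: downE; rewrite rmorphD s_inv addrC.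
have N0 (x : L) : x != 0 -> N x != 0.
  move=> x0; apply/eqP => Nx; have /esym/eqP := NE x.
  by rewrite Nx scale0r mulf_eq0 fmorph_eq0 orbb (negPf x0).
have NM (x y : L) : N (x * y) = N x * N y.
  by apply: (@scalar_inj K L); rewrite scalarM !NE rmorphM; ring.
have N_alg (k : K) : N k%:A = k ^+ 2.
  by apply: (@scalar_inj K L); rewrite NE s_alg -scalarM.
have [bounded|unbounded] := pselect (forall z : L, 0 <= p (N z) -> 0 <= p (T z)).
  apply: (@place_above_of_valuation _ _ p (p \o N) 2) => // [|k]; last first.
    by rewrite /= N_alg (valuationX p_val).
  split=> /=.
  - by rewrite -(scale0r (1 : L)) N_alg (valuationX p_val) Defs.ord0 mulr0.
  - by move=> x y x0 y0; rewrite NM ordM ?N0.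
  (* After dividing by the element of smaller norm: N (1 + z) = 1 + T z + N z. *)
  have one_le (x y : L) : x != 0 -> y != 0 -> x + y != 0 ->
      p (N x) <= p (N y) -> p (N x) <= p (N (x + y)).
    move=> x0 y0 xy0 xy; pose z := y / x.
    have yE : y = x * z by rewrite mulrC divfK.
    have xyE : x + y = x * (1 + z) by rewrite mulrDr mulr1 -yE.
    have z0 : z != 0 by rewrite mulf_neq0 ?invr_eq0.
    have z10 : 1 + z != 0.
      by apply: contra_neq xy0 => z1; rewrite xyE z1 mulr0.
    have Nz : 0 <= p (N z) by move: xy; rewrite yE NM ordM ?N0 //; lia.
    have -> : N (x + y) = N x * (1 + T z + N z).
      apply: (@scalar_inj K L); rewrite !scalarE !NE TE.
      by rewrite xyE rmorphM rmorphD rmorph1; ring.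
    have N1z : 1 + T z + N z != 0.
      have -> : 1 + T z + N z = N (1 + z).
        apply: (@scalar_inj K L); rewrite !scalarE !NE TE.
        by rewrite rmorphD rmorph1; ring.
      exact: N0.
    rewrite ordM ?N0 // lerDl; apply: (val_int_add p_val) => //.
    by apply: (val_int_add p_val); [rewrite (valuation1 p_val) | exact: bounded].
  move=> x y x0 y0 xy0; rewrite ge_min.
  have [xy|yx] := leP (p (N x)) (p (N y)); first by rewrite one_le.
  by rewrite [x + y]addrC one_le ?orbT 1?addrC // ltW.
have {unbounded} [z Nz Tz] : exists2 z, 0 <= p (N z) & p (T z) < 0.
  have [//|none] := pselect (exists2 z, 0 <= p (N z) & p (T z) < 0).
  case: unbounded => z Nz; rewrite leNgt; apply/negP => Tz.
  by apply: none; exists z.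
have T0 : T z != 0 by apply: contraTneq Tz => ->; rewrite Defs.ord0.
have TA0 : (T z)%:A != 0 :> L by rewrite scalar_eq0.
pose theta := z / (T z)%:A; pose h := N z / T z ^+ 2.
have s_theta : s theta = 1 - theta.
  rewrite /theta rmorphM fmorphV s_alg -[X in X - _](divff TA0) -mulrBl TE.
  by congr (_ / _); ring.
have hE : h%:A = theta * s theta.
  rewrite /h !scalarE NE /theta rmorphM fmorphV.
  by rewrite s_alg invfM; ring.
(* An element of K has integral trace as soon as its norm is integral. *)
have theta_ns : s theta != theta.
  apply/eqP => /s_fix [k kE].
  have zE : z = (k * T z)%:A.
    by rewrite scalarM kE /theta divfK.
  move: Nz; rewrite zE N_alg (valuationX p_val) => Nz.
  move: Tz; have -> : T z = 2%:R * (k * T z).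
    apply: (@scalar_inj K L); rewrite TE {1 2}zE s_alg !scalarE; ring.
  have kT : 0 <= p (k * T z) by lia.
  by have := val_int_mul p_val (val_int_nat p_val 2) kT; lia.
have d0 : theta - s theta != 0 by rewrite subr_eq0 eq_sym.
apply: (@split_place_above _ _ p theta h).
- rewrite /h; apply/val_geP; have [->|Nz0] := eqVneq (N z) 0.
    by left; rewrite mul0r.
  by right; rewrite (valuation_div p_val) ?expf_neq0 // (valuationX p_val); lia.
- by rewrite hE s_theta; ring.
- move=> x; have [b bE] : exists b : K, b%:A = (x - s x) / (theta - s theta).
    apply: s_fix; rewrite rmorphM fmorphV !rmorphB !s_inv -(opprB theta) -(opprB x).
    by rewrite invrN mulrNN.
  have [a aE] : exists a : K, a%:A = x - b%:A * theta.
    apply: s_fix; rewrite rmorphB rmorphM s_alg.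
    have : b%:A * (theta - s theta) = x - s x by rewrite bE divfK.
    move=> E; apply/eqP; rewrite -subr_eq0; apply/eqP.
    transitivity (b%:A * (theta - s theta) - (x - s x)); first by ring.
    by rewrite E subrr.
  by exists (a, b); rewrite /= aE subrK.
move=> a b ab0; have b0 : b = 0.
  have : s (a%:A + b%:A * theta) = 0 by rewrite ab0 rmorph0.
  rewrite rmorphD rmorphM !s_alg => sab0.
  have : b%:A * (theta - s theta) = 0.
    transitivity ((a%:A + b%:A * theta) - (a%:A + b%:A * s theta)); first by ring.
    by rewrite ab0 sab0 subrr.
  move/eqP; rewrite mulf_eq0 (negPf d0) orbF scalar_eq0.
  by move/eqP.
split=> //; move/eqP: ab0; rewrite b0 scale0r mul0r addr0 scalar_eq0.
by move/eqP.
Qed.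

End Quadratic.

(** Trades the Galois group for a single involution of L, through which the
    norm, the base field and the permutation of the roots are then handled. *)
Lemma quadratic_conjugation (K : fieldType) (L : splittingFieldType K) :
  galois 1 {:L} -> ('Gal({:L} / 1) \isog Zp 2)%g ->
  exists s : {rmorphism L -> L},
    [/\ forall k : K, s k%:A = k%:A, involutive s,
        forall x : L, s x = x -> exists k : K, k%:A = x,
        forall x, galNorm 1 {:L} x = x * s x
      & forall es : seq L, <<1 & es>>%VS = {:L}%VS ->
          exists2 e, e \in es & s e != e].
Proof.
move=> galL /card_isog; rewrite card_Zp // => /eqP /cards2P[g1 [g2 [g12 GE]]].
have [g [g_neq1 {}GE]] : exists g : gal_of {:L}, g != 1%g /\
    'Gal({:L} / 1)%g = [set 1%g; g]%SET.
  have : (1%g : gal_of {:L}) \in 'Gal({:L} / 1)%g by exact: group1.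
  rewrite GE !inE => /orP[]/eqP g1E.
    by exists g2; rewrite g1E eq_sym.
  by exists g1; rewrite g1E finset.setUC.
have gG : g \in 'Gal({:L} / 1)%g by rewrite GE !inE eqxx orbT.
have g_alg (k : K) : g k%:A = k%:A.
  by apply: fixed_gal gG _; [exact: sub1v | exact: rpredZ (mem1v _)].
have gg : (g * g = 1)%g.
  have : (g * g)%g \in 'Gal({:L} / 1)%g by exact: groupM.
  rewrite GE !inE => /orP[/eqP //|/eqP ggE].
  by case/eqP: g_neq1; apply: (mulgI g); rewrite ggE mulg1.
exists (g : {rmorphism L -> L}); split=> //.
- by move=> x; have := galM g g (memvf x); rewrite gg gal_id.
- move=> x gx; have : x \in fixedField 'Gal({:L} / 1)%g.
    apply/fixedFieldP; rewrite ?memvf // => h; rewrite GE !inE.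
    by move=> /orP[]/eqP-> //; rewrite gal_id.
  by rewrite (galois_fixedField galL) => /vlineP[k ->]; exists k.
- by move=> x; rewrite /galNorm GE big_setU1 ?inE 1?eq_sym // big_set1 gal_id.
move=> es esE; have [/hasP[e e_in ge]|] := boolP (has (fun e => g e != e) es).
  by exists e.
rewrite -all_predC => /allP /= fix_es; case/eqP: g_neq1.
apply/eqP/gal_eqP => x _; rewrite gal_id.
suff /fixedFieldP -> // : x \in fixedField [set g]%SET; rewrite ?memvf ?inE //.
have /subvP : (<<1 & es>> <= fixedField [set g]%SET)%VS.
  apply/Fadjoin_seqP; split; first exact: sub1v.
  move=> e e_in; apply/fixedFieldP; rewrite ?memvf // => h; rewrite inE.
  by move=> /eqP->; apply/eqP/negPn; exact: fix_es.
by rewrite esE; apply; rewrite memvf.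
Qed.

(** * Weierstrass equations with rational 2-torsion *)

Definition map_weierstrass (F F' : fieldType) (f : {rmorphism F -> F'})
    (W : weierstrass F) : weierstrass F' :=
  {| wa1 := f (wa1 W); wa2 := f (wa2 W); wa3 := f (wa3 W);
     wa4 := f (wa4 W); wa6 := f (wa6 W) |}.

Section MapWeierstrass.
Variables (F F' : fieldType) (f : {rmorphism F -> F'}) (W : weierstrass F).

Let rmE := (rmorph_nat, rmorphXn, fmorphV, rmorphN, rmorphB, rmorphD, rmorphM).

Lemma map_b2 : b2 (map_weierstrass f W) = f (b2 W).
Proof. by rewrite /b2 /= !rmE. Qed.

Lemma map_b4 : b4 (map_weierstrass f W) = f (b4 W).
Proof. by rewrite /b4 /= !rmE. Qed.

Lemma map_b6 : b6 (map_weierstrass f W) = f (b6 W).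
Proof. by rewrite /b6 /= !rmE. Qed.

Lemma map_discriminant : discriminant (map_weierstrass f W) = f (discriminant W).
Proof. by rewrite /discriminant /b8 map_b2 map_b4 map_b6 /= !rmE. Qed.

Lemma map_change_coordinates u r s t :
  map_weierstrass f (change_coordinates W u r s t)
  = change_coordinates (map_weierstrass f W) (f u) (f r) (f s) (f t).
Proof. by rewrite /map_weierstrass /change_coordinates /= !rmE. Qed.

End MapWeierstrass.

Lemma discriminant_change (F : fieldType) (W : weierstrass F) u r s t :
  u != 0 -> discriminant (change_coordinates W u r s t) = discriminant W / u ^+ 12.
Proof.
by move=> u0; rewrite /discriminant /b8 /b2 /b4 /b6 /=; field.
Qed.

(** Vieta's relations for f_2 = 4 (X - e1) (X - e2) (X - e3). *)
Definition two_torsion_roots (F : fieldType) (W : weierstrass F) (e1 e2 e3 : F) :=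
  [/\ b2 W = - 4%:R * (e1 + e2 + e3),
      2%:R * b4 W = 4%:R * (e1 * e2 + e1 * e3 + e2 * e3)
    & b6 W = - 4%:R * (e1 * e2 * e3)].

Lemma two_division_field_roots (K : fieldType) (L : splittingFieldType K)
    (E : elliptic_curve K) (e1 e2 e3 : L) :
  two_division_field E e1 e2 e3 ->
  two_torsion_roots (map_weierstrass (in_alg L) E) e1 e2 e3.
Proof.
case=> polyE _; rewrite /two_torsion_roots map_b2 map_b4 map_b6.
have coefE' (i : nat) : (i < 3)%N ->
    in_alg L (two_division_poly E)`_i
    = (4%:R *: (('X - e1%:P) * ('X - e2%:P) * ('X - e3%:P)))`_i.
  by move=> _; rewrite -polyE coef_map.
have prodE : ('X - e1%:P) * ('X - e2%:P) * ('X - e3%:P) = 'X^3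
    - (e1 + e2 + e3) *: 'X^2 + (e1 * e2 + e1 * e3 + e2 * e3) *: 'X - (e1 * e2 * e3)%:P.
  by rewrite -!mul_polyC !rmorphD !rmorphM /=; ring.
have := coefE' 2%N isT; have := coefE' 1%N isT; have := coefE' 0%N isT.
rewrite prodE /two_division_poly !coefE /= !(mulr0, mulr1, addr0, add0r, subr0, sub0r).
move=> h0 h1 h2; split; first by rewrite h2; ring.
  transitivity (in_alg L (2%:R * b4 E)); first by rewrite rmorphM rmorph_nat.
  by rewrite [LHS]h1; ring.
by rewrite h0; ring.
Qed.

Section TwoTorsion.
Variables (F : fieldType) (W : weierstrass F) (e1 e2 e3 : F).
Hypothesis two_neq0 : 2%:R != 0 :> F.
Hypothesis W_roots : two_torsion_roots W e1 e2 e3.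

Lemma two_torsion_discriminant :
  discriminant W = 2%:R ^+ 4 * ((e1 - e2) * (e1 - e3) * (e2 - e3)) ^+ 2.
Proof.
case: W_roots => W2 W4 W6; have four_neq0 : 4%:R != 0 :> F.
  by rewrite (natrM _ 2 2) mulf_neq0.
have {}W4 : b4 W = 2%:R * (e1 * e2 + e1 * e3 + e2 * e3).
  by apply: (mulfI two_neq0); rewrite W4; ring.
(* Over the integers only 4 b8, and not b8, is a polynomial in b2, b4, b6. *)
have W8 : 4%:R * b8 W = b2 W * b6 W - b4 W ^+ 2.
  by rewrite /b8 /b2 /b4 /b6; ring.
apply: (mulfI four_neq0); transitivity (- b2 W ^+ 2 * (4%:R * b8 W)
   - 32%:R * b4 W ^+ 3 - 108%:R * b6 W ^+ 2 + 36%:R * b2 W * b4 W * b6 W).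
  by rewrite /discriminant; ring.
by rewrite W8 W2 W4 W6; ring.
Qed.

Lemma two_torsion_rootsP e : e = e1 \/ e = e2 \/ e = e3 <->
  4%:R * e ^+ 3 + b2 W * e ^+ 2 + 2%:R * b4 W * e + b6 W = 0.
Proof.
case: W_roots => -> -> ->; have four_neq0 : 4%:R != 0 :> F.
  by rewrite (natrM _ 2 2) mulf_neq0.
have -> : 4%:R * e ^+ 3 + - 4%:R * (e1 + e2 + e3) * e ^+ 2
    + 4%:R * (e1 * e2 + e1 * e3 + e2 * e3) * e + - 4%:R * (e1 * e2 * e3)
    = 4%:R * ((e - e1) * ((e - e2) * (e - e3))) by ring.
split=> [[|[]] ->|/eqP]; rewrite ?subrr ?(mul0r, mulr0) //.
rewrite !mulf_eq0 (negPf four_neq0) /= !subr_eq0.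
by case/or3P => /eqP->; [left | right; left | right; right].
Qed.

Lemma two_torsion_roots_change u r s t : u != 0 ->
  two_torsion_roots (change_coordinates W u r s t)
    ((e1 - r) / u ^+ 2) ((e2 - r) / u ^+ 2) ((e3 - r) / u ^+ 2).
Proof.
move=> u0; case: W_roots => W2 W4 W6; split.
- transitivity ((b2 W + 12%:R * r) / u ^+ 2); first by rewrite /b2 /=; field.
  by rewrite W2; field.
- transitivity ((2%:R * b4 W + 2%:R * r * b2 W + 12%:R * r ^+ 2) / u ^+ 4).
    by rewrite /b4 /b2 /=; field.
  by rewrite W2 W4; field.
- transitivity ((b6 W + r * (2%:R * b4 W) + r ^+ 2 * b2 W + 4%:R * r ^+ 3) / u ^+ 6).
    by rewrite /b6 /b4 /b2 /=; field.
  by rewrite W2 W4 W6; field.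
Qed.

Variable P : place F.
Hypothesis P2 : P 2%:R = 0.
Let P_val : is_valuation P := place_is_valuation P.

Lemma two_torsion_integral (e : F) : integral_at W P ->
  e = e1 \/ e = e2 \/ e = e3 -> 0 <= P e.
Proof.
case=> Pa1 Pa2 Pa3 Pa4 Pa6 /two_torsion_rootsP root_e.
have Pn := val_int_nat P_val.
have Pb2 : 0 <= P (b2 W).
  by apply: (val_int_add P_val); [exact: val_int_exp | exact: val_int_mul].
have Pb4 : 0 <= P (2%:R * b4 W).
  by rewrite (val_int_mul P_val) // (val_int_add P_val) // (val_int_mul P_val).
have Pb6 : 0 <= P (b6 W).
  by apply: (val_int_add P_val); [exact: val_int_exp | exact: val_int_mul].
rewrite leNgt; apply/negP => Pe.
have e0 : e != 0 by apply: contraTneq Pe => ->; rewrite Defs.ord0.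
have four_neq0 : 4%:R != 0 :> F by rewrite (natrM _ 2 2) mulf_neq0.
have P4 : P 4%:R = 0 by rewrite (natrM _ 2 2) (valuationM P_val) // P2.
have P_lead : P (4%:R * e ^+ 3) = 3%:Z * P e.
  by rewrite (valuationM P_val) ?expf_neq0 // P4 (valuationX P_val) add0r.
(* The leading term has strictly the smallest valuation. *)
have [||sum_neq0 _] := val_add_dominant P_val (x := 4%:R * e ^+ 3)
    (y := b2 W * e ^+ 2 + 2%:R * b4 W * e + b6 W).
- by rewrite mulf_neq0 ?expf_neq0.
- rewrite P_lead; apply: (@val_ge_le _ _ (2%:Z * P e)); first by lia.
  have P_le (c : int) x : c <= 0 -> 0 <= P x -> val_ge P c x.
    by move=> c0 Px; apply: val_ge_le c0 _; rewrite val_ge0E.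
  apply: (val_geD P_val); first apply: (val_geD P_val).
  + rewrite -[2%:Z * P e]add0r; apply: (val_geM P_val); first exact: P_le.
    by rewrite -(valuationX P_val); exact: val_ge_refl.
  + apply: (@val_ge_le _ _ (0 + P e)); first by lia.
    by apply: (val_geM P_val); [exact: P_le | exact: val_ge_refl].
  + by apply: P_le => //; lia.
by case/eqP: sum_neq0; rewrite -[RHS]root_e; ring.
Qed.

(** The discriminant is, up to a unit, the square of the product of the three
    integral differences, so at a place of good reduction they are all units. *)
Lemma two_torsion_diff_unit : integral_at W P -> discriminant W != 0 ->
  P (discriminant W) = 0 ->
  [/\ P (e1 - e2) = 0, P (e1 - e3) = 0 & P (e2 - e3) = 0].
Proof.
move=> W_int; rewrite two_torsion_discriminant => D0.
have int_e e : e = e1 \/ e = e2 \/ e = e3 -> 0 <= P e.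
  exact: two_torsion_integral.
have P12 : 0 <= P (e1 - e2) by apply: (val_int_sub P_val); apply: int_e; tauto.
have P13 : 0 <= P (e1 - e3) by apply: (val_int_sub P_val); apply: int_e; tauto.
have P23 : 0 <= P (e2 - e3) by apply: (val_int_sub P_val); apply: int_e; tauto.
move: D0; rewrite mulf_eq0 negb_or !expf_eq0 /= => /andP[_].
rewrite !mulf_eq0 !negb_or -andbA => /and3P[d12 d13 d23].
rewrite (valuationM P_val) ?expf_neq0 ?mulf_neq0 // !(valuationX P_val) P2.
rewrite !(valuationM P_val) ?mulf_neq0 // => E.
by split; lia.
Qed.

End TwoTorsion.

Lemma lies_above_unit (K : fieldType) (L : splittingFieldType K) (P : place L)
    (p : place K) (k : K) : lies_above P p -> p k = 0 -> P k%:A = 0.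
Proof. by move=> [e [_ PE]] pk; rewrite PE pk mulr0. Qed.

Lemma lies_above_ge0 (K : fieldType) (L : splittingFieldType K) (P : place L)
    (p : place K) (k : K) : lies_above P p -> (0 <= P k%:A) = (0 <= p k).
Proof. by move=> [e [e_gt0 PE]]; rewrite PE pmulr_rge0. Qed.

(** A change of coordinates multiplies every e_i - e_j by the same square u^2, so
    the units found in a good model have the common valuation of u^2 in E. *)
Lemma good_reduction_two_torsion (K : fieldType) (L : splittingFieldType K)
    (P : place L) (p : place K) (E : elliptic_curve K) (e1 e2 e3 : L) :
  2%:R != 0 :> K -> p 2%:R = 0 -> lies_above P p -> good_reduction E p ->
  two_torsion_roots (map_weierstrass (in_alg L) E) e1 e2 e3 ->
  exists c, [/\ P (e1 - e2) = c, P (e1 - e3) = c & P (e2 - e3) = c].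
Proof.
move=> two0 p2 Pp [u [r [s [t [u0 E_int E_disc]]]]] E_roots.
have P_val := place_is_valuation P; pose f : {rmorphism K -> L} := in_alg L.
have two0L : 2%:R != 0 :> L by rewrite -(rmorph_nat f) fmorph_eq0.
have P2 : P 2%:R = 0 by rewrite -(scalar_nat L) (lies_above_unit Pp).
have fu0 : f u != 0 by rewrite fmorph_eq0.
pose W := map_weierstrass f (change_coordinates E u r s t).
have W_disc : discriminant W = f (discriminant (change_coordinates E u r s t)).
  exact: map_discriminant.
have W_roots := two_torsion_roots_change E_roots (f r) (f s) (f t) fu0.
rewrite -map_change_coordinates -/W in W_roots.
have [|||] := two_torsion_diff_unit two0L W_roots P2.
- by case: E_int => *; split; rewrite /= (lies_above_ge0 _ Pp).
- rewrite W_disc fmorph_eq0 discriminant_change // mulf_neq0 ?discriminant_neq0 //.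
  by rewrite invr_eq0 expf_neq0.
- by rewrite W_disc; exact: lies_above_unit Pp E_disc.
have diff x y : P ((x - f r) / f u ^+ 2 - (y - f r) / f u ^+ 2) = 0 -> x != y ->
    P (x - y) = P (f u ^+ 2).
  have -> : (x - f r) / f u ^+ 2 - (y - f r) / f u ^+ 2 = (x - y) / f u ^+ 2.
    by field.
  by move=> + xy; rewrite (valuation_div P_val) ?expf_neq0 ?subr_eq0 //; lia.
have := discriminant_neq0 E.
rewrite -(fmorph_eq0 f) -map_discriminant (two_torsion_discriminant two0L E_roots).
rewrite mulf_eq0 negb_or !expf_eq0 /= => /andP[_].
rewrite !mulf_eq0 !negb_or !subr_eq0 -andbA => /and3P[d12 d13 d23] h12 h13 h23.
by exists (P (f u ^+ 2)); split; exact: diff.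
Qed.

Lemma lambda_values_ratio (F : fieldType) (e1 e2 e3 l : F) :
  e1 != e2 -> e1 != e3 -> e2 != e3 -> l \in lambda_values e1 e2 e3 ->
  exists a b : F, [/\ a \in [:: e1 - e2; e1 - e3; e2 - e3],
    b \in [:: e1 - e2; e1 - e3; e2 - e3] & l = a / b \/ l = - (a / b)].
Proof.
rewrite -!(subr_eq0 e1) -!(subr_eq0 e2) => d12 d13 d23.
have one_sub : 1 - (e1 - e3) / (e1 - e2) = - ((e2 - e3) / (e1 - e2)) by field.
rewrite !inE => /or4P[|||/or3P[]] /eqP->.
- by exists (e1 - e3), (e1 - e2); rewrite !inE !eqxx ?orbT; split=> //; left.
- by exists (e2 - e3), (e1 - e2); rewrite !inE !eqxx ?orbT one_sub; split=> //; right.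
- by exists (e1 - e2), (e1 - e3); rewrite !inE !eqxx ?orbT invf_div; split=> //; left.
- exists (e1 - e2), (e2 - e3); rewrite !inE !eqxx ?orbT one_sub invrN invf_div.
  by split=> //; right.
- exists (e2 - e3), (e1 - e3); rewrite !inE !eqxx ?orbT; split=> //; left.
  by field; rewrite d12 d13.
- exists (e1 - e3), (e2 - e3); rewrite !inE !eqxx ?orbT; split=> //; left.
  have -> : (e1 - e3) / (e1 - e2) - 1 = (e2 - e3) / (e1 - e2) by field.
  by field; rewrite d12 d23.
Qed.

(** Conjugation fixes one root e_k and swaps the other two, e_i and e_j; hence
    it inverts the lambda-value (e_k - e_i) / (e_k - e_j). *)
Lemma exists_norm1_lambda (F : fieldType) (s : {rmorphism F -> F}) (e1 e2 e3 : F) :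
  involutive s -> e1 != e2 -> e1 != e3 -> e2 != e3 ->
  (forall e, e = e1 \/ e = e2 \/ e = e3 -> s e = e1 \/ s e = e2 \/ s e = e3) ->
  (exists2 e, e \in [:: e1; e2; e3] & s e != e) ->
  exists2 l, l \in lambda_values e1 e2 e3 & l * s l = 1.
Proof.
move=> s_inv d12 d13 d23 s_perm s_nontriv.
have s_inj := inv_inj s_inv.
have [[h1 [h2 h3]]|[[h2 [h1 h3]]|[h3 [h1 h2]]]] :
    (s e1 = e1 /\ s e2 = e3 /\ s e3 = e2) \/ (s e2 = e2 /\ s e1 = e3 /\ s e3 = e1)
    \/ (s e3 = e3 /\ s e1 = e2 /\ s e2 = e1).
  have ne x y z : x != y -> s x = z -> s y = z -> False.
    by move=> xy <- /s_inj E; rewrite E eqxx in xy.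
  have swap x y : s x = y -> s y = x by move=> <-.
  case: (s_perm e1) => [|h1|[h1|h1]]; first by left.
  - case: (s_perm e2) => [|h2|[h2|h2]]; first by right; left.
    + by case: (ne _ _ _ d12 h1 h2).
    + case: (s_perm e3) => [|h3|[h3|h3]]; first by right; right.
      * by case: (ne _ _ _ d13 h1 h3).
      * by case: (ne _ _ _ d23 h2 h3).
      * case: s_nontriv => e; rewrite !inE => /or3P[] /eqP->;
          by rewrite ?h1 ?h2 ?h3 eqxx.
    + by left; split=> //; split=> //; exact: swap.
  - have h2 := swap _ _ h1; case: (s_perm e3) => [|h3|[h3|h3]]; first by right; right.
    + by case: (ne _ _ _ d23 h2 h3).
    + by case: (ne _ _ _ d13 h1 h3).
    + by right; right.
  - have h3 := swap _ _ h1; case: (s_perm e2) => [|h2|[h2|h2]]; first by right; left.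
    + by case: (ne _ _ _ d23 h2 h3).
    + by right; left.
    + by case: (ne _ _ _ d12 h1 h2).
all: rewrite -!(subr_eq0 e1) -!(subr_eq0 e2) in d12 d13 d23.
all: have d21 : e2 - e1 != 0 by rewrite -opprB oppr_eq0.
- exists ((e1 - e3) / (e1 - e2)); first by rewrite inE eqxx.
  by rewrite rmorphM fmorphV !rmorphB h1 h2 h3; field; rewrite d12 d13.
- exists (1 - (e1 - e3) / (e1 - e2)); first by rewrite !inE eqxx orbT.
  have -> : 1 - (e1 - e3) / (e1 - e2) = (e2 - e3) / (e2 - e1).
    by field; rewrite d12 d21.
  by rewrite rmorphM fmorphV !rmorphB h1 h2 h3; field; rewrite d21 d23.
- exists ((e1 - e3) / (e1 - e2) / ((e1 - e3) / (e1 - e2) - 1)).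
    by rewrite !inE eqxx !orbT.
  have -> : (e1 - e3) / (e1 - e2) - 1 = (e2 - e3) / (e1 - e2) by field.
  have -> : (e1 - e3) / (e1 - e2) / ((e2 - e3) / (e1 - e2)) = (e1 - e3) / (e2 - e3).
    by field; rewrite d12 d23.
  by rewrite rmorphM fmorphV !rmorphB h1 h2 h3; field; rewrite d13 d23.
Qed.

Lemma lambda_jV (F : fieldType) (l : F) :
  l != 0 -> 1 - l != 0 -> lambda_j l^-1 = lambda_j l.
Proof.
move=> l0 m0; have m0' : l - 1 != 0 by rewrite -opprB oppr_eq0.
rewrite /lambda_j; have -> : 1 - l^-1 = (l - 1) / l by field.
by field; rewrite m0 l0 m0'.
Qed.

(** * Curves with prescribed invariants c4 and c6 *)

Definition short_weierstrass (F : fieldType) (c4 c6 : F) : weierstrass F :=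
  Weierstrass 0 0 0 (- (c4 / 48%:R)) (- (c6 / 864%:R)).

Section ShortWeierstrass.
Variable F : fieldType.
Hypothesis two0 : 2%:R != 0 :> F.
Hypothesis three0 : 3%:R != 0 :> F.

Lemma nat_2_3_neq0 a b : (2 ^ a * 3 ^ b)%:R != 0 :> F.
Proof. by rewrite natrM !natrX mulf_neq0 ?expf_neq0. Qed.

Lemma short_c4 (a b : F) : c4 (short_weierstrass a b) = a.
Proof.
by rewrite /c4 /b2 /b4 /=; field; exact: (nat_2_3_neq0 4 1).
Qed.

Lemma short_discriminant (a b : F) :
  discriminant (short_weierstrass a b) = (a ^+ 3 - b ^+ 2) / 1728%:R.
Proof.
rewrite /discriminant /b8 /b2 /b4 /b6 /=; field.
by rewrite (nat_2_3_neq0 4 1) (nat_2_3_neq0 5 3) (nat_2_3_neq0 6 3).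
Qed.

Lemma short_change (a b u : F) : u != 0 ->
  change_coordinates (short_weierstrass a b) u 0 0 0
  = short_weierstrass (a / u ^+ 4) (b / u ^+ 6).
Proof.
move=> u0; rewrite /change_coordinates /short_weierstrass /=.
have h48 := nat_2_3_neq0 4 1; have h864 := nat_2_3_neq0 5 3.
by congr Weierstrass; field; rewrite ?u0 ?h48 ?h864.
Qed.

(** Since c4^3 = j D and c6^2 = (j - 1728) D with j integral, scaling the
    discriminant D to a unit leaves integral invariants c4 and c6. *)
Lemma short_good_reduction (p : place F) (a b : F) (E : elliptic_curve F) :
  E = short_weierstrass a b :> weierstrass F ->
  p 2%:R = 0 -> p 3%:R = 0 ->
  0 <= p (j_invariant E) -> (12 %| p (discriminant E))%Z ->
  good_reduction E p.
Proof.
move=> EE p2 p3 pj /dvdzP[m pD]; have p_val := place_is_valuation p.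
have D0 := discriminant_neq0 E; set D := discriminant E in D0 pD.
have p_nat i j : p (2 ^ i * 3 ^ j)%:R = 0.
  rewrite natrM !natrX (valuationM p_val) ?expf_neq0 // !(valuationX p_val).
  by rewrite p2 p3 !mulr0.
have DE : D = (a ^+ 3 - b ^+ 2) / 1728%:R by rewrite /D EE short_discriminant.
have h1728 : 1728%:R != 0 :> F := nat_2_3_neq0 6 3.
have jE : j_invariant E = a ^+ 3 / D by rewrite /j_invariant EE short_c4 -EE.
have aE : a ^+ 3 = j_invariant E * D by rewrite jE divfK.
have bE : b ^+ 2 = (j_invariant E - 1728%:R) * D.
  by rewrite mulrBl -aE DE; field.
have pj1728 : 0 <= p (j_invariant E - 1728%:R).
  by apply: (val_int_sub p_val) => //; exact: val_int_nat.
have [pi ppi] := ord_surj p.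
have pi0 : pi != 0 by apply/eqP => pi0; move: ppi; rewrite pi0 Defs.ord0.
pose u := pi ^ m; have u0 : u != 0 by exact: expfz_neq0.
have pu : p u = m by rewrite /u (valuation_exprz p_val) ppi mulr1.
have pDu : p (D / u ^+ 12) = 0.
  by rewrite (valuation_div p_val) ?expf_neq0 // (valuationX p_val) pu pD; lia.
have pa : 0 <= p (a / u ^+ 4).
  have -> : (0 <= p (a / u ^+ 4)) = (0 <= p ((a / u ^+ 4) ^+ 3)).
    by rewrite (valuationX p_val) pmulr_rge0.
  have -> : (a / u ^+ 4) ^+ 3 = j_invariant E * (D / u ^+ 12).
    by rewrite mulrA -aE; field.
  by rewrite (val_int_mul p_val) ?pDu.
have pb : 0 <= p (b / u ^+ 6).
  have -> : (0 <= p (b / u ^+ 6)) = (0 <= p ((b / u ^+ 6) ^+ 2)).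
    by rewrite (valuationX p_val) pmulr_rge0.
  have -> : (b / u ^+ 6) ^+ 2 = (j_invariant E - 1728%:R) * (D / u ^+ 12).
    by rewrite mulrA -bE; field.
  by rewrite (val_int_mul p_val) ?pDu.
exists u, 0, 0, 0; split=> //; last by rewrite discriminant_change.
rewrite EE short_change //; split; rewrite /= ?Defs.ord0 // (valuationN p_val);
  rewrite (val_int_mul p_val) // (valuationV p_val).
  by rewrite (p_nat 4 1).
by rewrite (p_nat 5 3).
Qed.

End ShortWeierstrass.

(** * Lambda-values of norm 1 and their j-invariants *)

Lemma lies_above_complement (K : fieldType) (L : splittingFieldType K)
    (T : set (place K)) (P : place L) (p : place K) :
  lies_above P p -> places_above T P <-> T p.
Proof.
move=> Pp; split=> [[q Tq /(lies_above_inj Pp)->] //|Tp].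
by exists p.
Qed.

Lemma not_extend_places (F : fieldType) (S : set (place F)) n (p : place F) :
  ~ extend_places S n p <-> ~ S p /\ p n%:R = 0.
Proof.
have p_ge0 := val_int_nat (place_is_valuation p) n.
split=> [nSp|[nSp pn] [//|]]; last by rewrite /= pn ltxx.
split=> [Sp|]; first by apply: nSp; left.
by apply/eqP; rewrite eq_le p_ge0 andbT leNgt; apply/negP => pn; apply: nSp; right.
Qed.

Lemma nat_neq0 (K : fieldExtType rat) n : (0 < n)%N -> n%:R != 0 :> K.
Proof.
by move=> n0; rewrite -(rmorph_nat (in_alg K)) fmorph_eq0 pnatr_eq0 -lt0n.
Qed.

Lemma place_six (F : fieldType) (p : place F) :
  2%:R != 0 :> F -> 3%:R != 0 :> F -> p 6%:R = 0 -> p 2%:R = 0 /\ p 3%:R = 0.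
Proof.
move=> two0 three0; have p_val := place_is_valuation p.
have := val_int_nat p_val 2; have := val_int_nat p_val 3.
by rewrite (natrM _ 2 3) (valuationM p_val) //; lia.
Qed.

(** The j-invariant lies in K as conjugation inverts l.  A place p of K outside
    S is nonnegative on it because p extends to a place P of L, where l and
    1 - l are units. *)
Lemma lambda_j_integral (K : fieldType) (L : splittingFieldType K)
    (S : set (place K)) (s : {rmorphism L -> L}) (l : L) :
  (forall k : K, s k%:A = k%:A) -> involutive s ->
  (forall x : L, s x = x -> exists k : K, k%:A = x) ->
  S_units (places_above S) l -> S_units (places_above S) (1 - l) ->
  l * s l = 1 ->
  exists2 k : K, S_integers S k & k%:A = lambda_j l.
Proof.
move=> s_alg s_inv s_fix [l0 l_unit] [m0 m_unit] norm_l.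
have slE : s l = l^-1 by apply: (mulfI l0); rewrite norm_l divff.
have [|k kE] := s_fix (lambda_j l).
  rewrite -[RHS](lambda_jV l0 m0) -slE /lambda_j.
  by rewrite !(rmorph_nat, rmorphXn, fmorphV, rmorphB, rmorphD, rmorphM, rmorph1).
exists k => // p nSp; have [P Pp] := place_above s_alg s_inv s_fix p.
have P_val := place_is_valuation P.
have nSP : ~ places_above S P by move/(lies_above_complement _ Pp).
have Pl := l_unit P nSP; have Pm := m_unit P nSP.
rewrite -(lies_above_ge0 _ Pp) kE /lambda_j.
have den : P (l ^+ 2 * (1 - l) ^+ 2) = 0.
  by rewrite (valuationM P_val) ?expf_neq0 // !(valuationX P_val) Pl Pm.
apply: (val_int_mul P_val); last by rewrite (valuationV P_val) den.
have Pl0 : 0 <= P l by rewrite Pl.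
apply: (val_int_mul P_val).
  by apply: (val_int_exp P_val); exact: val_int_nat.
apply: (val_int_exp P_val); apply: (val_int_add P_val).
  by apply: (val_int_sub P_val) => //; exact: val_int_exp.
by rewrite (valuation1 P_val).
Qed.

(** If k^2 (k - 1728)^3 = x y^6, the curve with c4 = k (k - 1728) / y^2 and
    c6 = k (k - 1728)^2 / y^3 has discriminant x and j-invariant k. *)
Lemma exists_good_reduction_curve (K : fieldType) (S : set (place K)) (k : K) :
  2%:R != 0 :> K -> 3%:R != 0 :> K -> k != 0 -> k != 1728%:R ->
  S_integers (extend_places S 2) k ->
  selmer_image S 6 12 (k ^+ 2 * (k - 1728%:R) ^+ 3) ->
  exists E : elliptic_curve K,
    j_invariant E = k /\ good_reduction_outside E (extend_places S 6).
Proof.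
move=> two0 three0 k0 k1728 k_int [x [y [[x0 x_dvd] y0 wE]]].
have h1728 : 1728%:R != 0 :> K := nat_2_3_neq0 two0 three0 6 3.
have k1728' : k - 1728%:R != 0 by rewrite subr_eq0.
pose a := k * (k - 1728%:R) / y ^+ 2; pose b := k * (k - 1728%:R) ^+ 2 / y ^+ 3.
have discE : discriminant (short_weierstrass a b) = x.
  rewrite short_discriminant // /a /b.
  have -> : x = k ^+ 2 * (k - 1728%:R) ^+ 3 / y ^+ 6.
    by rewrite wE mulfK ?expf_neq0.
  by field; rewrite h1728 y0.
have disc0 : discriminant (short_weierstrass a b) != 0 by rewrite discE.
pose E := EllipticCurve disc0.
have jE : j_invariant E = k.
  rewrite /j_invariant discE short_c4 // /a.
  have -> : x = k ^+ 2 * (k - 1728%:R) ^+ 3 / y ^+ 6.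
    by rewrite wE mulfK ?expf_neq0.
  by field; rewrite k0 k1728' y0.
exists E; split=> // p /not_extend_places[nSp p6].
have [p2 p3] := place_six two0 three0 p6.
apply: (@short_good_reduction _ two0 three0 _ a b) => //.
  by rewrite jE; apply: k_int; apply/not_extend_places.
by rewrite discE; exact: x_dvd.
Qed.

Theorem theorem4p1 (K : fieldExtType rat) (S : set (place K))
    (L : splittingFieldType K) :
  finite_set S ->
  galois 1 {:L} ->
  ('Gal({:L} / 1) \isog Zp 2)%g ->
  unramified_outside L (extend_places S 2) ->
  let SL : set (place L) := places_above (extend_places S 2) in
  (forall (E : elliptic_curve K) (e1 e2 e3 : L),
     good_reduction_outside E S ->
     j_invariant E != 0 -> j_invariant E != 1728%:R ->
     two_division_field E e1 e2 e3 ->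
     (forall l : L, l \in lambda_values e1 e2 e3 -> S_units SL l) /\
     (exists2 l : L, l \in lambda_values e1 e2 e3 & norm1_S_units SL l))
  /\
  (forall l : L,
     S_units SL l ->
     let mu := 1 - l in
     let j := lambda_j l in
     let w := j ^+ 2 * (j - 1728%:R) ^+ 3 in
     j != 0 -> j != 1728%:R ->
     S_units SL mu -> norm1_S_units SL l ->
     [set x%:A | x in S_integers (extend_places S 2)] j /\
     ([set x%:A | x in selmer_image S 6 12] w ->
      exists E : elliptic_curve K,
        (j_invariant E)%:A = j /\
        good_reduction_outside E (extend_places S 6))).
Proof.
move=> _ galL isogL _ SL.
have [s [s_alg s_inv s_fix s_norm s_nontriv]] := quadratic_conjugation galL isogL.
have two0 := nat_neq0 K (isT : 0 < 2)%N; have three0 := nat_neq0 K (isT : 0 < 3)%N.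
split=> [E e1 e2 e3 goodE _ _ divE|l l_unit mu j w j0 j1728 mu_unit [_ norm_l]].
  pose f : {rmorphism K -> L} := in_alg L.
  have E_roots := two_division_field_roots divE.
  have two0L : 2%:R != 0 :> L by rewrite -(rmorph_nat f) fmorph_eq0.
  have := discriminant_neq0 E.
  rewrite -(fmorph_eq0 f) -map_discriminant (two_torsion_discriminant two0L E_roots).
  rewrite mulf_eq0 negb_or !expf_eq0 /= => /andP[_].
  rewrite !mulf_eq0 !negb_or -andbA => /and3P[d12 d13 d23].
  have [e12 e13 e23] : [/\ e1 != e2, e1 != e3 & e2 != e3].
    by rewrite -(subr_eq0 e1) -(subr_eq0 e1 e3) -(subr_eq0 e2).
  have units l : l \in lambda_values e1 e2 e3 -> S_units SL l.
    move=> /(lambda_values_ratio e12 e13 e23)[a [b [a_in b_in lE]]].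
    have diff0 (x : L) : x \in [:: e1 - e2; e1 - e3; e2 - e3] -> x != 0.
      by rewrite !inE => /or3P[] /eqP->.
    have a0 := diff0 _ a_in; have b0 := diff0 _ b_in.
    split=> [|P nSP].
      by case: lE => ->; rewrite ?oppr_eq0 mulf_neq0 ?invr_eq0.
    have P_val := place_is_valuation P.
    have [p Pp] := place_below s_inv s_fix P.
    have /not_extend_places[nSp p2] : ~ extend_places S 2 p.
      by move/(lies_above_complement _ Pp).
    have [c [c12 c13 c23]] :=
      good_reduction_two_torsion two0 p2 Pp (goodE p nSp) E_roots.
    have Pdiff (x : L) : x \in [:: e1 - e2; e1 - e3; e2 - e3] -> P x = c.
      by rewrite !inE => /or3P[] /eqP->.
    have Pab : P (a / b) = 0.
      by rewrite (valuation_div P_val) // !Pdiff // subrr.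
    by case: lE => ->; rewrite ?(valuationN P_val).
  split=> //; have [||l l_in norm_l] := exists_norm1_lambda s_inv e12 e13 e23.
  - move=> e /(two_torsion_rootsP two0L E_roots) root_e.
    apply/(two_torsion_rootsP two0L E_roots); rewrite map_b2 map_b4 map_b6 in root_e *.
    rewrite -[RHS](rmorph0 s) -root_e.
    by rewrite !(rmorph_nat, rmorphXn, rmorphD, rmorphM) !s_alg.
  - by apply: s_nontriv; case: divE.
  by exists l => //; split; [exact: units | rewrite s_norm].
have [k k_int kE] := lambda_j_integral s_alg s_inv s_fix l_unit mu_unit
  (etrans (esym (s_norm l)) norm_l).
split=> [|[x x_in xE]]; first by exists k.
have k0 : k != 0 by rewrite -(scalar_eq0 L) kE.
have k1728 : k != 1728%:R.
  by apply: contra_neq j1728 => k1728; rewrite /j -kE k1728 scalar_nat.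
have x_w : x = k ^+ 2 * (k - 1728%:R) ^+ 3.
  apply: (@scalar_inj K L); rewrite xE /w /j -kE.
  by rewrite scalarM !scalarX scalerBl scalar_nat.
rewrite x_w in x_in.
have [E [jE E_good]] := exists_good_reduction_curve two0 three0 k0 k1728 k_int x_in.
by exists E; rewrite jE kE.
Qed.
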